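(* There exist a positive integer $n$ and a nonnegative $3$-dimensional matrix $A$ of order $n$ such that $\operatorname{per}(A\otimes A)<(\operatorname{per}A)^{2n}$, where $\otimes$ denotes the Kronecker product.
   Context: Let $I_n^d = \{1,\ldots,n\}^d$ with $n,d$ positive integers. A $d$-dimensional matrix $A$ of order $n$ is an array $(a_\alpha)_{\alpha\in I_n^d}$ of real numbers; it is nonnegative if all $a_\alpha\ge0$. A diagonal in a $d$-dimensional matrix of order $n$ is a set of indices $\{\alpha^1,\ldots,\alpha^n\}\subset I_n^d$ such that $\alpha^i_k\ne\alpha^j_k$ for all $k\in\{1,\ldots,d\}$ and all $i\neq j$. With $\mathcal{D}(A)$ the set of all diagonals, the permanent of $A$ is $\operatorname{per}A=\sum_{D\in\mathcal{D}(A)}\prod_{\alpha\in D}a_\alpha$. The Kronecker product $A\otimes B$ of a $d$-dimensional matrix $A$ of order $n_1$ and a $d$-dimensional matrix $B$ of order $n_2$ is the $d$-dimensional matrix $C$ of order $n_1n_2$ with entries $c_\gamma = a_\alpha b_\beta$, where $\gamma_i = (\alpha_i-1)n_2+\beta_i$ for each $i=1,\ldots,d$. *)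

(* Defs.v *)
From HB Require Import structures.
From mathcomp Require Import all_boot all_order all_algebra.
From mathcomp Require Import mxtens reals.

Set Implicit Arguments.
Unset Strict Implicit.
Unset Printing Implicit Defensive.

Import Order.TTheory GRing.Theory Num.Theory.
Local Open Scope ring_scope.

(* I_n^d, with coordinates ranging over {0, ..., n-1}. *)
Definition mindex (d n : nat) : finType := {ffun 'I_d -> 'I_n}.

Definition dmatrix (R : realType) (d n : nat) := {ffun mindex d n -> R}.

Definition nonneg_dmatrix (R : realType) (d n : nat) (A : dmatrix R d n) :=
  forall a : mindex d n, 0 <= A a.

(* A diagonal is a set of indices, so distinct elements are required to differ
   in every coordinate and the number of elements is imposed separately. *)
Definition is_diagonal (d n : nat) (D : {set mindex d n}) : bool :=
  (#|D| == n) &&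
  [forall a in D, forall b in D, (a != b) ==> [forall k, a k != b k]].

Definition per (R : realType) (d n : nat) (A : dmatrix R d n) : R :=
  \sum_(D : {set mindex d n} | is_diagonal D) \prod_(a in D) A a.

(* [mxtens_unindex] splits k : 'I_(n1 * n2) into (k %/ n2, k %% n2): it is the
   inverse of (i, j) |-> i * n2 + j, which is (i - 1) n2 + j for 1-based
   indices; see [kroneckerE]. *)
Definition kronecker (R : realType) (d n1 n2 : nat)
    (A : dmatrix R d n1) (B : dmatrix R d n2) : dmatrix R d (n1 * n2) :=
  [ffun g : mindex d (n1 * n2) =>
     A [ffun i => (mxtens_unindex (g i)).1] *
     B [ffun i => (mxtens_unindex (g i)).2]].

Lemma kroneckerE (R : realType) (d n1 n2 : nat)
    (A : dmatrix R d n1) (B : dmatrix R d n2)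
    (a : mindex d n1) (b : mindex d n2) (g : mindex d (n1 * n2)) :
  (forall i, g i = (a i * n2 + b i)%N :> nat) ->
  kronecker A B g = A a * B b.
Proof.
move=> Eg; have E i : g i = mxtens_index (a i, b i) by apply: ord_inj; apply: Eg.
by rewrite ffunE; congr (A _ * B _); apply/ffunP => i; rewrite ffunE E mxtens_indexK.
Qed.

(* Main.v *)
Require Import Defs.
From mathcomp Require Import all_boot all_order all_algebra.
From mathcomp Require Import reals.
From mathcomp Require Import mxtens.

Set Implicit Arguments.
Unset Strict Implicit.
Unset Printing Implicit Defensive.

Import GRing.Theory Num.Theory.
Local Open Scope ring_scope.

(** The witness has order 3 and is a 0/1 matrix.  Identify ['I_3] with the field
    F_3, both as the set of positions and as the range of coordinates, so that
    an index is a function F_3 -> F_3; the support consists of the six affine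
    functions k |-> i + k * s with i in F_3 and slope s in {0, 1}.

    A diagonal of this support is a choice of slopes s(i) for which
    i |-> i + k * s(i) is a permutation for every k.  The two constant choices
    work, so the permanent is at least 2, and 2 ^ 6 = 64 has to be beaten.

    The support of the Kronecker square consists of the affine functions
    k |-> v + k * c with v in the plane F_3 ^ 2 and slope c in {0, 1} ^ 2, so
    its diagonals are the maps f from the plane to {0, 1} ^ 2 such that
    v |-> v + k * f(v) is a permutation for every k ([diagonal_slopes]).
    Equivalently, the line through two points u and v is never parallel to a
    nonzero difference f(u) - f(v).  Each of the four directions of the plane is
    the direction of such a difference, so this is very restrictive: f must be
    constant, or take two values a and b and be constant on the lines parallel
    to a - b.  That makes 4 + 6 * (2 ^ 3 - 2) = 40 maps.  A point-by-point search
    confirms the count ([card_good_slopes]), and 40 < 64. *)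

(** * Permanents of 0/1 matrices *)

Definition indicator (R : realType) (d n : nat) (S : pred (mindex d n)) :
  dmatrix R d n := [ffun a => (S a)%:R].

Definition diagonals_in (d n : nat) (S : pred (mindex d n)) :
  {set {set mindex d n}} := [set D | is_diagonal D & D \subset S].

Lemma per_indicator (R : realType) (d n : nat) (S : pred (mindex d n)) :
  per (indicator R S) = #|diagonals_in S|%:R.
Proof.
have prodE (D : {set mindex d n}) :
    \prod_(a in D) indicator R S a = (D \subset S)%:R.
  case: (boolP (D \subset S)) => [/subsetP DS | /subsetPn[a aD aS]].
    by rewrite big1 // => a /DS aS; rewrite ffunE (_ : S a = true).
  by rewrite (bigD1 a) //= ffunE (_ : S a = false) ?mul0r //; apply: negbTE.
rewrite /per; under eq_bigr => D _ do rewrite prodE.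
rewrite -natr_sum; congr (_%:R).
rewrite -sum1_card; under [RHS]eq_bigl => D do rewrite inE.
by rewrite [RHS]big_mkcondr; apply: eq_bigr => D _; case: (_ \subset _).
Qed.

Lemma kronecker_indicator (R : realType) (d n1 n2 : nat)
    (S : pred (mindex d n1)) (T : pred (mindex d n2)) :
  kronecker (indicator R S) (indicator R T) =
  indicator R (fun g : mindex d (n1 * n2) =>
    S [ffun i => (mxtens_unindex (g i)).1] &&
    T [ffun i => (mxtens_unindex (g i)).2]).
Proof. by apply/ffunP => g; rewrite !ffunE -natrM mulnb. Qed.

Lemma diagonal_neq d n (D : {set mindex d n}) a b (k : 'I_d) :
  is_diagonal D -> a \in D -> b \in D -> a != b -> a k != b k.
Proof.
case/andP=> _ /forall_inP/(_ a) H aD bD nab.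
by have /forall_inP/(_ b bD) := H aD; rewrite nab => /forallP/(_ k).
Qed.

Lemma diagonal_surj d n (D : {set mindex d n}) (k : 'I_d) (v : 'I_n) :
  is_diagonal D -> exists2 a, a \in D & a k = v.
Proof.
move=> dD; have injk : {in D &, injective (fun a : mindex d n => a k)}.
  move=> a b aD bD eab; apply/eqP; apply: contraT => nab.
  by have := diagonal_neq k dD aD bD nab; rewrite eab eqxx.
have : [set a k | a : mindex d n in D] = setT.
  apply/eqP; rewrite eqEcard subsetT cardsT card_ord card_in_imset //.
  by case/andP: dD => /eqP->; rewrite leqnn.
by move=> /setP/(_ v); rewrite in_setT => /imsetP[a aD ->]; exists a.
Qed.

(** * The affine support and its two diagonals *)

Definition affine (i : 'I_3) (s : bool) : mindex 3 3 :=
  [ffun k : 'I_3 => i + k *+ s].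

Definition affine_support : pred (mindex 3 3) :=
  fun a => [exists i, exists s, a == affine i s].

Lemma affine_inj s k : injective (fun i => affine i s k).
Proof. by move=> i j; rewrite !ffunE => /addIr. Qed.

Definition parallel_class (s : bool) : {set mindex 3 3} :=
  [set affine i s | i : 'I_3].

Lemma parallel_class_diagonal s : parallel_class s \in diagonals_in affine_support.
Proof.
rewrite inE; apply/andP; split; last first.
  apply/subsetP => _ /imsetP[i _ ->].
  by apply/existsP; exists i; apply/existsP; exists s.
apply/andP; split.
  rewrite card_imset ?card_ord // => i j eij.
  by apply: (@affine_inj s ord0); rewrite /= eij.
apply/forall_inP => _ /imsetP[i _ ->]; apply/forall_inP => _ /imsetP[j _ ->].
apply/implyP => nij; apply/forallP => k; apply: contra nij => /eqP/affine_inj->.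
exact: eqxx.
Qed.

Lemma parallel_class_neq : parallel_class false != parallel_class true.
Proof.
apply/eqP => E; have : affine 0 false \in parallel_class true.
  by rewrite -E; apply: imset_f.
case/imsetP=> i _ /ffunP Ei; have := Ei 0; have := Ei 1.
rewrite !ffunE /= !mulr0n !mulr1n !addr0 => e1 e0.
by move: e1; rewrite -e0.
Qed.

Lemma two_diagonals : (2 <= #|diagonals_in affine_support|)%N.
Proof.
have card2 : #|[set parallel_class false; parallel_class true]| = 2%N.
  by rewrite cards2 parallel_class_neq.
apply: leq_trans (eq_leq (esym card2)) _; apply/subset_leq_card/subsetP => D.
by rewrite in_set2 => /orP[] /eqP->; apply: parallel_class_diagonal.
Qed.

(** * Diagonals of the Kronecker square as slope fields on the plane *)

Definition plane := ('I_3 * 'I_3)%type.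
Definition slope := (bool * bool)%type.

Definition affine2 (v : plane) (c : slope) (k : 'I_3) : plane :=
  (v.1 + k *+ c.1, v.2 + k *+ c.2).

Definition tensor_affine (v : plane) (c : slope) : mindex 3 (3 * 3) :=
  [ffun k => mxtens_index (affine2 v c k)].

Definition tensor_support : pred (mindex 3 (3 * 3)) := fun g =>
  affine_support [ffun i => (mxtens_unindex (g i)).1] &&
  affine_support [ffun i => (mxtens_unindex (g i)).2].

Lemma tensor_supportP g :
  tensor_support g -> exists v c, g = tensor_affine v c.
Proof.
case/andP=> /existsP[i /existsP[s /eqP/ffunP E1]].
case/existsP=> j /existsP[t /eqP/ffunP E2].
exists (i, j), (s, t); apply/ffunP => k.
have eg : affine2 (i, j) (s, t) k = mxtens_unindex (g k).
  rewrite [RHS]surjective_pairing; move: (E1 k) (E2 k).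
  by rewrite !ffunE => -> ->.
by rewrite ffunE eg mxtens_unindexK.
Qed.

Lemma tensor_affine0 v c : tensor_affine v c 0 = mxtens_index v.
Proof. by rewrite ffunE /affine2 !mul0rn !addr0 -surjective_pairing. Qed.

(** The two sides differ at k = 0 as soon as the base points do, which leaves
    k = 1 and k = -1. *)
Definition compatible (x y : plane * slope) : bool :=
  (affine2 x.1 x.2 1 != affine2 y.1 y.2 1) &&
  (affine2 x.1 x.2 (-1) != affine2 y.1 y.2 (-1)).

Definition good_slopes : {set {ffun plane -> slope}} :=
  [set f : {ffun plane -> slope} | [forall u : plane,
    forall v : plane, (u != v) ==> compatible (u, f u) (v, f v)]].

Definition graph (f : {ffun plane -> slope}) : {set mindex 3 (3 * 3)} :=
  [set tensor_affine v (f v) | v : plane].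

(** Coordinate 0 of the members of a diagonal runs through all points of the
    plane once, and the member starting at [v] is determined by its slope. *)
Lemma diagonal_slopes D :
  D \in diagonals_in tensor_support -> exists2 f, f \in good_slopes & D = graph f.
Proof.
rewrite inE => /andP[dD /subsetP DS].
have through v : exists c, tensor_affine v c \in D.
  have [a aD a0] := diagonal_surj 0 (mxtens_index v) dD.
  have [w [c ea]] := tensor_supportP (DS a aD); exists c.
  suff <- : w = v by rewrite -ea.
  by apply: (can_inj (@mxtens_indexK _ _)); rewrite -a0 ea tensor_affine0.
have [f fD] := fin_all_exists through.
have base_inj : injective (fun v => tensor_affine v (f v)).
  move=> u v /ffunP/(_ 0); rewrite !tensor_affine0.
  exact: (can_inj (@mxtens_indexK _ _)).
exists (finfun f); last first.
  apply/esym/eqP; rewrite eqEcard; apply/andP; split.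
    by apply/subsetP => _ /imsetP[v _ ->]; rewrite ffunE.
  rewrite card_imset; last by move=> u v; rewrite !ffunE => /base_inj.
  by rewrite card_prod card_ord; case/andP: dD => /eqP->.
rewrite inE; apply/forallP => u; apply/forallP => v; apply/implyP => nuv.
have nk k : affine2 u (f u) k != affine2 v (f v) k.
  have := diagonal_neq k dD (fD u) (fD v).
  rewrite (inj_eq base_inj) => /(_ nuv); rewrite [_ k]ffunE [X in _ != X]ffunE.
  by apply: contra => /eqP->.
by rewrite /compatible /= !ffunE !nk.
Qed.

(** * Counting the slope fields *)

Fixpoint colourings {P C : Type} (r : rel (P * C)) (cs : seq C) (ps : seq P) :
    seq (seq C) :=
  if ps is p :: ps' then
    flatten [seq [seq c :: s | c <- cs & all (r (p, c)) (zip ps' s)]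
            | s <- colourings r cs ps']
  else [:: [::]].

Lemma colouringsP (P C : eqType) (r : rel (P * C)) (cs : seq C) (ps : seq P)
    (f : P -> C) :
  uniq ps -> (forall p, f p \in cs) ->
  (forall p q, p != q -> r (p, f p) (q, f q)) ->
  map f ps \in colourings r cs ps.
Proof.
move=> + fcs fr; elim: ps => [|p ps IH] //= /andP[pps /IH mem_tail].
apply/flatten_mapP; exists (map f ps) => //; apply: map_f.
rewrite mem_filter fcs andbT; apply/allP => -[q c].
have -> : zip ps (map f ps) = [seq (q', f q') | q' <- ps].
  by elim: (ps) => //= a l ->.
by case/mapP=> q' q'ps [-> ->]; apply: fr; apply: contraNneq pps => ->.
Qed.

Definition plane_points : seq plane :=
  [seq (inZp i, inZp j) | i <- iota 0 3, j <- iota 0 3].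

Definition slopes : seq slope :=
  [:: (false, false); (false, true); (true, false); (true, true)].

Lemma mem_plane_points v : v \in plane_points.
Proof.
case: v => i j; apply/allpairsP; exists (i : nat, j : nat).
by rewrite !mem_iota !ltn_ord !valZpK.
Qed.

Lemma size_compatible_colourings :
  size (colourings compatible slopes plane_points) = 40%N.
Proof. by vm_compute. Qed.

Lemma card_good_slopes : (#|good_slopes| <= 40)%N.
Proof.
pose code (f : {ffun plane -> slope}) := map f plane_points.
have code_inj : injective code.
  by move=> f g /eq_in_map efg; apply/ffunP => v; apply/efg/mem_plane_points.
rewrite -size_compatible_colourings cardE -(size_map code).
apply: uniq_leq_size => [|_ /mapP[f + ->]]; first by rewrite map_inj_uniq ?enum_uniq.
rewrite mem_enum inE => /forallP good; apply: colouringsP.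
- by vm_compute.
- by move=> v; case: (f v) => -[] [].
- by move=> u v nuv; have /forallP/(_ v)/implyP := good u; apply.
Qed.

Lemma card_tensor_diagonals : (#|diagonals_in tensor_support| <= 40)%N.
Proof.
apply: leq_trans card_good_slopes; apply: leq_trans (leq_imset_card graph _).
apply/subset_leq_card/subsetP => D /diagonal_slopes[f fgood ->].
exact: imset_f.
Qed.

Theorem mainTheorem9 (R : realType) :
  exists (n : nat) (A : dmatrix R 3 n),
    [/\ (0 < n)%N, nonneg_dmatrix A & per (kronecker A A) < per A ^+ (2 * n)].
Proof.
exists 3%N, (indicator R affine_support); split => //.
  by move=> a; rewrite ffunE ler0n.
rewrite kronecker_indicator !per_indicator -natrX ltr_nat.
apply: (leq_ltn_trans card_tensor_diagonals).
by apply: (@leq_trans (2 ^ 6)%N) => //; rewrite leq_exp2r // two_diagonals.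
Qed.
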